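(* Let $(X,\|\cdot\|)$ be a (real) Banach space with a normalized monotone Schauder basis $(e_n)_{n\in\mathbb{N}}$ with biorthogonal functionals $(e_n^* )_{n\in\mathbb{N}}$. Let also $C_1,C_2>0$. The following statements (1), (2), (3) are equivalent. (1) The operator $\Phi:X^*\to\mathcal{L}_{\mathrm{diag}}(X)$ defined by the rule $$w^*\text{-}\sum_{n=1}^\infty\lambda_ne_n^*\;\longmapsto\;\mathrm{SOT}\text{-}\sum_{n=1}^\infty\lambda_n\overline{\mathbf{e}}_n$$ is well defined, onto, and $C_1\|\sum_{n=1}^\infty\lambda_ne_n^*\|\le\|\sum_{n=1}^\infty\lambda_n\overline{\mathbf{e}}_n\|\le C_2\|\sum_{n=1}^\infty\lambda_ne_n^*\|$ for every $x^*=w^*\text{-}\sum_{n=1}^\infty\lambda_ne_n^*\in X^*$. (2) (a) The basis $(e_n)$ dominates the summing basis with constant $C_1$, i.e. $C_1|\sum_{i=1}^n\mu_i|\le\|\sum_{i=1}^n\mu_ie_i\|$ for every finite sequence of scalars $(\mu_i)_{i=1}^n$; and (b) the norm of $X^*$ is submultiplicative with constant $C_2$, i.e. $\|\sum_{i=1}^na_i\beta_ie_i^*\|\le C_2\|\sum_{i=1}^na_ie_i^*\|\cdot\|\sum_{i=1}^n\beta_ie_i^*\|$ for every $n\in\mathbb{N}$ and all $a_1,\beta_1,\ldots,a_n,\beta_n\in\mathbb{R}$. (3) There exists a $1$-norming set $K$ of $X$, contained in the linear span of $(e_n^* )_{n\in\mathbb{N}}$, such that (a) $\pm C_1\sum_{i=1}^ne_i^*\in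 K$ for all $n$, and (b) $K\cdot K\subset C_2B_{X^*}$.
   Context: $\mathcal{L}_{\mathrm{diag}}(X)$ denotes the space, with the operator norm, of all bounded linear operators $T:X\to X$ for which there is a scalar sequence $(\lambda_n)_{n}$ with $Te_n=\lambda_ne_n$ for all $n$. $\overline{\mathbf{e}}_n=e_n^*\otimes e_n$ is the rank one operator $\sum_i\mu_ie_i\mapsto\mu_ne_n$. Every $x^*\in X^*$ is the $w^*$-convergent sum $w^*\text{-}\sum_n\lambda_ne_n^*$ with $\lambda_n=x^*(e_n)$; SOT denotes the strong operator topology. A basis is monotone if its partial sum projections have norm at most $1$. A set $K\subset X^*$ is $1$-norming for $X$ if $\|x\|=\sup\{f(x):f\in K\}$ for all $x\in X$. $B_{X^*}$ is the closed unit ball of $X^*$. For $f=\sum a_ie_i^*$ and $g=\sum\beta_ie_i^*$ (finite sums), $f\cdot g=\sum a_i\beta_ie_i^*$, and $K\cdot K=\{f\cdot g:f,g\in K\}$. *)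

(* Defs.v *)
From HB Require Import structures.
From mathcomp Require Import all_boot all_order all_algebra.
From mathcomp Require Import all_classical all_reals all_analysis.
Set Implicit Arguments.
Unset Strict Implicit.
Unset Printing Implicit Defensive.
Import Order.TTheory GRing.Theory Num.Theory.
Import numFieldNormedType.Exports.

Local Open Scope classical_set_scope.
Local Open Scope ring_scope.

Definition bounded_op (R : realType) (X Y : normedModType R) : set (X -> Y) :=
  [set T | linear T /\ exists M : R, forall x, `|T x| <= M * `|x|].

(* [sup] is total: the value is the operator norm only on [bounded_op]. *)
Definition opnorm (R : realType) (X Y : normedModType R) (T : X -> Y) : R :=
  sup [set `|T x| | x in [set x : X | `|x| <= 1]].

Definition dual (R : realType) (X : normedModType R) : set (X -> R^o) :=
  bounded_op (X := X) (Y := R^o).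
Arguments dual {R} X.

Definition dual_ball (R : realType) (X : normedModType R) : set (X -> R^o) :=
  [set f | dual X f /\ opnorm f <= 1].
Arguments dual_ball {R} X.

Definition schauder_basis (R : realType) (X : normedModType R) (e : nat -> X) :
    Prop :=
  forall x : X, exists! a : nat -> R, series (fun n => a n *: e n) @ \oo --> x.

Definition normalized (R : realType) (X : normedModType R) (e : nat -> X) :
    Prop :=
  forall n, `|e n| = 1.

Definition biorthogonal (R : realType) (X : normedModType R) (e : nat -> X)
    (es : nat -> X -> R^o) : Prop :=
  (forall n, dual X (es n)) /\ (forall n m, es n (e m) = (n == m)%:R).

(* The rank one operator [es n] (x) [e n]. *)
Definition rank1 (R : realType) (X : normedModType R) (e : nat -> X)
    (es : nat -> X -> R^o) (n : nat) : X -> X :=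
  fun x => es n x *: e n.

Definition monotone_basis (R : realType) (X : normedModType R) (e : nat -> X)
    (es : nat -> X -> R^o) : Prop :=
  forall n, opnorm (\sum_(i < n) rank1 e es i) <= 1.

Definition Ldiag (R : realType) (X : normedModType R) (e : nat -> X) :
    set (X -> X) :=
  [set T | bounded_op T /\
           exists lam : nat -> R, forall n, T (e n) = lam n *: e n].

(* On [dual X] the weak-* topology, and on operators the strong operator
   topology, are the topologies of pointwise convergence. *)
Definition wstar_sum (R : realType) (X : normedModType R)
    (es : nat -> X -> R^o) (lam : nat -> R) (xs : X -> R^o) : Prop :=
  {ptws, series (fun n => lam n *: es n) @ \oo --> xs}.

Definition sot_sum (R : realType) (X : normedModType R) (e : nat -> X)
    (es : nat -> X -> R^o) (lam : nat -> R) (T : X -> X) : Prop :=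
  {ptws, series (fun n => lam n *: rank1 e es n) @ \oo --> T}.

Definition finspan (R : realType) (X : normedModType R)
    (es : nat -> X -> R^o) : set (X -> R^o) :=
  [set f | exists (n : nat) (a : nat -> R), f = \sum_(i < n) a i *: es i].

(* [K . K] for the coordinatewise product of finite sums; two finite sums can
   always be written with the same number of terms. *)
Definition coordprod (R : realType) (X : normedModType R)
    (es : nat -> X -> R^o) (K : set (X -> R^o)) : set (X -> R^o) :=
  [set h | exists (n : nat) (a b : nat -> R),
     [/\ K (\sum_(i < n) a i *: es i), K (\sum_(i < n) b i *: es i)
       & h = \sum_(i < n) (a i * b i) *: es i]].

(* The supremum is taken in the extended reals, so that it is not given a
   junk value when the set of values is empty or unbounded. *)
Definition one_norming (R : realType) (X : normedModType R)
    (K : set (X -> R^o)) : Prop :=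
  K `<=` dual X /\
  forall x : X, (`|x|)%:E = ereal_sup [set (f x : R)%:E | f in K].

(* Main.v *)
(** (1) => (2): for a finite sum f = sum_(i < n) e_i^*, Phi f is the basis
    projection, of norm at most 1, so C1 * |f| <= 1; and the coordinatewise
    product of finite sums f and g is the composition of f with Phi g.
    (2) => (3): K is the unit ball of the linear span of the e_i^*; it is
    norming because a finite-dimensional Hahn-Banach functional on the span of
    e_0, ..., e_(n-1), composed with the basis projection, lies in K.
    (3) => (1): for f in K, testing against K bounds the diagonal operator with
    entries f(e_i) by C2 on finite vectors; by duality the diagonal operator
    with entries x^*(e_i) is bounded there by C2 * |x^*|, and it extends to X
    along the basis expansion. Conversely, applying the partial sum functionals
    C1 * sum_(i < n) e_i^* of K to a diagonal operator recovers a functional of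
    norm at most |T| / C1. *)
Require Import Defs.
From HB Require Import structures.
From mathcomp Require Import all_boot all_order all_algebra.
From mathcomp Require Import all_classical all_reals all_analysis.
Import Order.TTheory GRing.Theory Num.Theory.
Import numFieldNormedType.Exports.
Local Open Scope classical_set_scope.
Local Open Scope ring_scope.

(** Bundling [T] as a linear map makes [linear_sum], [linearZ] and the continuity criterion for
    linear maps applicable to it. *)
Lemma linear_funE (R : realType) (X Y : normedModType R) (T : X -> Y) :
  linear T -> exists T' : {linear X -> Y}, T = T' :> (X -> Y).
Proof.
move=> lT; pose T' : {linear X -> Y} :=
  HB.pack T (GRing.isLinear.Build R X Y *:%R T lT).
by exists T'.
Qed.

(** * Bounded operators and the operator norm *)

Section BoundedOperators.
Context {R : realType} {X Y : normedModType R}.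
Implicit Types (S T : X -> Y) (M : R).

Lemma opnorm_has_ubound T :
  bounded_op T -> has_ubound [set `|T x| | x in [set x : X | `|x| <= 1]].
Proof.
move=> [_ [M TM]]; exists `|M| => _ [x /= x1 <-].
apply: (le_trans (TM x)); apply: (le_trans (ler_norm _)).
by rewrite normrM normr_id ler_piMr.
Qed.

Lemma opnorm_ge0 T : bounded_op T -> 0 <= opnorm T.
Proof.
move=> bT; apply: (le_trans (normr_ge0 (T 0))).
by apply: ub_le_sup; [exact: opnorm_has_ubound|exists 0; rewrite //= normr0].
Qed.

Lemma le_opnorm T x : bounded_op T -> `|T x| <= opnorm T * `|x|.
Proof.
move=> bT; have [T' TE] := linear_funE _ _ _ _ bT.1.
have [->|x0] := eqVneq x 0; first by rewrite TE linear0 !normr0 mulr0.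
have nx : 0 < `|x| by rewrite normr_gt0.
rewrite -ler_pdivrMr // mulrC -[_^-1]gtr0_norm ?invr_gt0//.
rewrite -normrZ TE -linearZ -TE.
apply: ub_le_sup; first exact: opnorm_has_ubound.
by exists (`|x|^-1 *: x) => //=; rewrite normrZ normfV normr_id mulVf// gt_eqF.
Qed.

Lemma opnorm_le T M :
  0 <= M -> (forall x, `|T x| <= M * `|x|) -> opnorm T <= M.
Proof.
move=> M0 TM; apply: ge_sup.
  by exists `|T 0|, 0 => //=; rewrite normr0.
move=> _ [x /= x1 <-]; apply: (le_trans (TM x)).
by rewrite ler_piMr.
Qed.

Lemma bounded_op_lincomb c S T :
  bounded_op S -> bounded_op T -> bounded_op (c *: S + T).
Proof.
move=> [lS [M SM]] [lT [N TN]]; split.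
  move=> a x y /=; rewrite !fctE lS lT !scalerDr !scalerA mulrC.
  by rewrite addrACA.
exists (`|c| * M + N) => x; rewrite fctE mulrDl (le_trans (ler_normD _ _))//.
by rewrite lerD// normrZ -mulrA ler_wpM2l.
Qed.

Lemma bounded_op_sum n (a : nat -> R) (F : nat -> X -> Y) :
  (forall i, bounded_op (F i)) -> bounded_op (\sum_(i < n) a i *: F i).
Proof.
move=> bF; elim: n => [|n IHn]; last first.
  by rewrite big_ord_recr /= addrC; exact: bounded_op_lincomb.
rewrite big_ord0; have zE x : (0 : X -> Y) x = 0 by [].
split; first by move=> c x y; rewrite !zE scaler0 addr0.
by exists 0 => x; rewrite zE normr0 mul0r.
Qed.

Lemma bounded_op_finsum T n (mu : nat -> R) (e : nat -> X) : bounded_op T ->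
  T (\sum_(i < n) mu i *: e i) = \sum_(i < n) mu i *: T (e i).
Proof.
move=> bT; have [T' ->] := linear_funE _ _ _ _ bT.1.
by rewrite linear_sum; apply: eq_bigr => i _; rewrite linearZ.
Qed.

Lemma bounded_op_cvg T (u : nat -> X) x :
  bounded_op T -> u @ \oo --> x -> T (u n) @[n --> \oo] --> T x.
Proof.
move=> bT ux; have [T' TE] := linear_funE _ _ _ _ bT.1.
have cT : continuous T.
  rewrite TE; apply: bounded_linear_continuous; apply/linear_boundedP.
  case: bT => _ [M TM]; near=> r => z; rewrite -TE (le_trans (TM z))//.
  by rewrite ler_wpM2r//; near: r; exact: nbhs_pinfty_ge.
by apply: continuous_cvg => //; exact: cT.
Unshelve. all: by end_near. Qed.

End BoundedOperators.

Section Composition.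
Context {R : realType} {X Y Z : normedModType R}.
Implicit Types (S : Y -> Z) (T : X -> Y).

Lemma le_opnorm_comp S T x :
  bounded_op S -> bounded_op T ->
  `|S (T x)| <= opnorm S * opnorm T * `|x|.
Proof.
move=> bS bT; rewrite (le_trans (le_opnorm S _ _))// -mulrA.
by rewrite ler_wpM2l ?opnorm_ge0 ?le_opnorm.
Qed.

Lemma bounded_op_comp S T :
  bounded_op S -> bounded_op T -> bounded_op (S \o T).
Proof.
move=> bS bT; split; first by move=> c x y /=; rewrite bT.1 bS.1.
by exists (opnorm S * opnorm T) => x; exact: le_opnorm_comp.
Qed.

Lemma opnorm_comp S T :
  bounded_op S -> bounded_op T -> opnorm (S \o T) <= opnorm S * opnorm T.
Proof.
move=> bS bT; apply: opnorm_le => [|x]; last exact: le_opnorm_comp.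
by rewrite mulr_ge0 ?opnorm_ge0.
Qed.

End Composition.

(* The standard one-dimensional extension step, iterated; the inequality for
   all coefficients makes the functional [y |-> `|y|], [u i |-> a i] well
   defined on the span without speaking of subspaces. *)
Lemma finite_hahn_banach (R : realType) (V : normedModType R) (y : V)
    (u : nat -> V) n :
  exists a : nat -> R, forall t (mu : nat -> R),
    t * `|y| + \sum_(i < n) a i * mu i <= `|t *: y + \sum_(i < n) mu i *: u i|.
Proof.
elim: n => [|n [a IHn]].
  exists (fun=> 0) => t mu; rewrite !big_ord0 !addr0 normrZ.
  by rewrite ler_wpM2r// ler_norm.
pose L (p : R * (nat -> R)) := p.1 * `|y| + \sum_(i < n) a i * p.2 i.
pose W (p : R * (nat -> R)) := p.1 *: y + \sum_(i < n) p.2 i *: u i.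
have LW p : L p <= `|W p| by exact: IHn.
have LD p q : L p + L q = L (p.1 + q.1, fun i => p.2 i + q.2 i).
  rewrite /L /= addrACA mulrDl -big_split; congr (_ + _ + _).
  by apply: eq_bigr => i _; rewrite mulrDr.
have WD p q : W p + W q = W (p.1 + q.1, fun i => p.2 i + q.2 i).
  rewrite /W /= addrACA scalerDl -big_split; congr (_ + _ + _).
  by apply: eq_bigr => i _; rewrite scalerDl.
have LZ s p : L (s * p.1, fun i => s * p.2 i) = s * L p.
  rewrite /L /= mulrDr mulrA mulr_sumr; congr (_ + _).
  by apply: eq_bigr => i _; rewrite mulrCA.
have WZ s p : W (s * p.1, fun i => s * p.2 i) = s *: W p.
  rewrite /W /= scalerDr scalerA scaler_sumr; congr (_ + _).
  by apply: eq_bigr => i _; rewrite scalerA.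
(* Each lower bound for the value at [u n] lies below each upper bound, since [u n] cancels in the
   sum of [W q + u n] and [W p - u n]. Any number between the two families is an admissible value;
   [c] is the supremum of the lower bounds. *)
have LWn p q : L p - `|W p - u n| <= `|W q + u n| - L q.
  rewrite lerBlDr addrAC lerBrDr LD (le_trans (LW _))// -WD.
  have -> : W p + W q = (W q + u n) + (W p - u n).
    by rewrite [RHS]addrACA subrr addr0 addrC.
  exact: ler_normD.
pose E := [set L p - `|W p - u n| | p in setT].
pose c := sup E.
have c_ge p : L p - `|W p - u n| <= c.
  apply: ub_le_sup; last by exists p.
  by exists (`|W p + u n| - L p) => _ [q _ <-].
have c_le p : c <= `|W p + u n| - L p.
  apply: ge_sup; first by exists (L p - `|W p - u n|), p.
  by move=> _ [q _ <-].
exists (fun i => if i == n then c else a i) => t mu.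
rewrite !big_ord_recr /= eqxx !addrA.
under eq_bigr => i _ do rewrite ltn_eqF//.
pose s := mu n.
rewrite -[leLHS]/(L (t, mu) + c * s) -[X in _ <= `|X|]/(W (t, mu) + s *: u n).
(* By homogeneity only the sign of [s] matters: dividing by its absolute value reduces a negative
   [s] to [c_ge] and a positive one to [c_le], while [s = 0] is the induction hypothesis. *)
have [s0|s0|->] := ltrgtP s 0; last by rewrite mulr0 scale0r !addr0.
- have ns0 : 0 < - s by rewrite oppr_gt0.
  have := c_ge ((- s)^-1 * t, fun i => (- s)^-1 * mu i).
  rewrite (LZ _ (t, mu)) (WZ _ (t, mu)) -(ler_pM2l ns0) mulrBr mulrA.
  rewrite mulfV ?gt_eqF// mul1r -[X in X * `|_|](gtr0_norm ns0) -normrZ scalerBr scalerA.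
  rewrite mulfV ?gt_eqF// scale1r scaleNr opprK mulNr.
  by rewrite lerBlDr -lerBlDl opprK mulrC.
- have := c_le (s^-1 * t, fun i => s^-1 * mu i).
  rewrite (LZ _ (t, mu)) (WZ _ (t, mu)) -(ler_pM2l s0) mulrBr mulrA.
  rewrite mulfV ?gt_eqF// mul1r -[X in X * `|_|](gtr0_norm s0) -normrZ scalerDr scalerA.
  by rewrite mulfV ?gt_eqF// scale1r lerBrDr addrC mulrC.
Qed.

Lemma cvgn_unique {R : realType} {V : normedModType R} (u : nat -> V) (a b : V) :
  u n @[n --> \oo] --> a -> u n @[n --> \oo] --> b -> a = b.
Proof. exact/cvg_unique/norm_hausdorff. Qed.

(** * Expansions along a Schauder basis *)

Section SchauderBasis.
Context {R : realType} {X : normedModType R} {e : nat -> X}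
  {es : nat -> X -> R^o}.
Hypotheses (he : schauder_basis e) (hes : biorthogonal e es).

Lemma finsum_appE n (a : nat -> R) x :
  (\sum_(i < n) a i *: es i) x = \sum_(i < n) a i * es i x.
Proof. by rewrite fct_sumE; apply: eq_bigr => i _. Qed.

Lemma finsum_dual n (a : nat -> R) : dual X (\sum_(i < n) a i *: es i).
Proof. exact/bounded_op_sum/hes.1. Qed.

Lemma sum_es_basis {Z : normedModType R} (w : nat -> Z) n m :
  \sum_(i < n) es i (e m) *: w i = if (m < n)%N then w m else 0.
Proof.
case: ltnP => [ltmn|lenm]; last first.
  rewrite big1// => i _; rewrite hes.2 ltn_eqF ?scale0r//.
  exact: leq_trans lenm.
rewrite (bigD1 (Ordinal ltmn)) //= hes.2 eqxx scale1r big1 ?addr0// => i iNm.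
by rewrite -(inj_eq val_inj)/= in iNm; rewrite hes.2 (negbTE iNm) scale0r.
Qed.

Lemma finsum_app_basis n (a : nat -> R) m :
  (\sum_(i < n) a i *: es i) (e m) = if (m < n)%N then a m else 0.
Proof.
rewrite finsum_appE -(@sum_es_basis R^o).
by apply: eq_bigr => i _; exact: mulrC.
Qed.

Lemma finsum_coef n (mu : nat -> R) i : (i < n)%N ->
  es i (\sum_(j < n) mu j *: e j) = mu i.
Proof.
move=> lin; rewrite (bounded_op_finsum _ _ _ _ (hes.1 i)).
have := @sum_es_basis R^o mu n i; rewrite lin => <-.
by apply: eq_bigr => j _; rewrite !hes.2 eq_sym; exact: mulrC.
Qed.

(** The continuous functional [es i] takes a constant value on the partial sums of any expansion of
    [x] once they pass the index [i], so the coefficients provided by [he] are the [es i x]. *)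
Lemma proj_cvg x : \sum_(i < n) es i x *: e i @[n --> \oo] --> x.
Proof.
have [a [ax _]] := he x.
have esx i : es i x = a i.
  apply: (cvgn_unique _ _ _ (bounded_op_cvg _ _ _ (hes.1 i) ax)).
  apply: cvg_near_cst; near=> n.
  rewrite seriesEord finsum_coef //; near: n; exact: nbhs_infty_gt.
under eq_fun do under eq_bigr do rewrite esx.
by move: ax; rewrite seriesEord.
Unshelve. all: by end_near. Qed.

Lemma bounded_op_expansion {Y : normedModType R} (T : X -> Y) x :
  bounded_op T -> \sum_(i < n) es i x *: T (e i) @[n --> \oo] --> T x.
Proof.
move=> bT; have := @bounded_op_cvg _ _ _ _ _ _ bT (proj_cvg x).
by under eq_fun do rewrite (bounded_op_finsum T _ (fun i => es i x))//.
Qed.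

(** A bounded operator is the pointwise limit of its basis expansion, hence is determined by its
    values on the basis. *)
Lemma bounded_op_ext {Y : normedModType R} (S T : X -> Y) :
  bounded_op S -> bounded_op T -> (forall n, S (e n) = T (e n)) -> S = T.
Proof.
move=> bS bT ST; apply/funext => x.
have := bounded_op_expansion _ x bT.
under eq_fun do under eq_bigr do rewrite -ST.
by move=> /(cvgn_unique _ _ _ (bounded_op_expansion _ x bS)).
Qed.

Lemma wstar_sum_coef (lam : nat -> R) (f : X -> R^o) n :
  wstar_sum es lam f -> lam n = f (e n).
Proof.
move=> /pointwise_cvgP/(_ (e n)) fn; apply: esym.
apply: (cvgn_unique _ _ _ fn).
apply: cvg_near_cst; near=> m.
rewrite seriesEord /= finsum_app_basis ifT //; near: m; exact: nbhs_infty_gt.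
Unshelve. all: by end_near. Qed.

Lemma dual_wstar_sum (f : X -> R^o) :
  dual X f -> wstar_sum es (fun n => f (e n)) f.
Proof.
move=> bf; apply/pointwise_cvgP => x; pose lam n : R := f (e n).
have E : (fun n => \sum_(i < n) es i x *: f (e i)) =
    fun n => series (fun n => lam n *: es n) n x.
  apply/funext => n; rewrite seriesEord /= finsum_appE; apply: eq_bigr => i _.
  exact: mulrC.
by have := bounded_op_expansion _ x bf; rewrite E.
Qed.

Lemma sot_sumP (lam : nat -> R) (T : X -> X) : sot_sum e es lam T <->
  forall x, \sum_(i < n) es i x *: (lam i *: e i) @[n --> \oo] --> T x.
Proof.
have E n x : series (fun n => lam n *: rank1 e es n) n x =
    \sum_(i < n) es i x *: (lam i *: e i).
  rewrite seriesEord /= fct_sumE; apply: eq_bigr => i _.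
  by rewrite fctE /rank1 !scalerA mulrC.
split=> [/pointwise_cvgP cT x|cT].
  apply: (cvg_trans _ (cT x)); apply: near_eq_cvg; apply: nearW => n.
  exact: E.
apply/pointwise_cvgP => x.
suff : (fun n => series (fun n => lam n *: rank1 e es n) n x) @ \oo --> T x.
  by [].
apply: (cvg_trans _ (cT x)).
apply: near_eq_cvg; apply: nearW => n; exact/esym/E.
Qed.

Lemma bounded_op_sot_sum (lam : nat -> R) (T : X -> X) : bounded_op T ->
  (forall n, T (e n) = lam n *: e n) -> sot_sum e es lam T.
Proof.
move=> bT Te; apply/sot_sumP => x.
by under eq_fun do under eq_bigr do rewrite -Te; exact: bounded_op_expansion.
Qed.

Lemma proj_bounded n : bounded_op (\sum_(i < n) rank1 e es i).
Proof.
have -> : \sum_(i < n) rank1 e es i = \sum_(i < n) 1 *: rank1 e es i.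
  by apply: eq_bigr => i _; rewrite scale1r.
apply: (bounded_op_sum n (fun=> 1) (rank1 e es)) => i.
have [li [M Mi]] := hes.1 i; split.
  by move=> c y z; rewrite /rank1 li scalerDl -scalerA.
by exists (M * `|e i|) => y; rewrite normrZ mulrAC ler_wpM2r.
Qed.

Lemma proj_le n x :
  monotone_basis e es -> `|\sum_(i < n) es i x *: e i| <= `|x|.
Proof.
move=> hm; have := le_opnorm _ x (proj_bounded n); rewrite {1}fct_sumE.
by move=> /le_trans; apply; rewrite ler_piMl.
Qed.

Lemma sot_sum_basis (lam : nat -> R) (T : X -> X) n :
  sot_sum e es lam T -> T (e n) = lam n *: e n.
Proof.
move=> /sot_sumP/(_ (e n)) cT; apply: (cvgn_unique _ _ _ cT).
apply: cvg_near_cst; near=> m.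
rewrite (sum_es_basis (fun i => lam i *: e i)) ifT//; near: m; exact: nbhs_infty_gt.
Unshelve. all: by end_near. Qed.

(** The coefficients are the values on the basis, which vanish beyond the length of [f]. Allowing
    every large [m] lets two elements of the span share a number of terms, as [coordprod]
    requires. *)
Lemma finspan_pad f : finspan es f ->
  exists n, forall m, (n <= m)%N -> f = \sum_(i < m) (f (e i) : R) *: es i.
Proof.
move=> [n [a fE]]; exists n => m lenm.
apply: bounded_op_ext => [||k].
- by rewrite fE; exact: finsum_dual.
- exact: (finsum_dual m (f \o e)).
- rewrite (finsum_app_basis m (f \o e))/=; case: ltnP => // lemk.
  by rewrite fE finsum_app_basis ltnNge (leq_trans lenm lemk).
Qed.

(** Blocks of the series with terms [es i x *: v i] are dominated by blocks of the expansion of [x],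
    so the series is Cauchy and completeness of [Y] supplies [S x]. The case [Y = X] yields diagonal
    operators, the case [Y = R^o] functionals. *)
Lemma dominated_op {Y : completeNormedModType R} (v : nat -> Y) (M : R) : 0 <= M ->
  (forall n (mu : nat -> R),
     `|\sum_(i < n) mu i *: v i| <= M * `|\sum_(i < n) mu i *: e i|) ->
  exists S : X -> Y,
    [/\ bounded_op S, forall x, `|S x| <= M * `|x| & forall n, S (e n) = v n].
Proof.
move=> M0 vM.
have cv x : exists l : Y, \sum_(i < n) es i x *: v i @[n --> \oo] --> l.
  suff : cvgn (series (fun i => es i x *: v i)).
    by rewrite seriesEord => ?; eexists; eassumption.
  apply/cauchy_cvgP/cauchy_seriesP => eps eps0.
  (* Dividing by [M + 1] rather than [M] covers the case [M = 0]. *)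
  have M1 : 0 < M + 1 by rewrite ltr_wpDl.
  have /cauchy_seriesP/(_ (eps / (M + 1))) :
      cauchy (series (fun i => es i x *: e i) @ \oo).
    by apply: cvg_cauchy; apply: cvgP; rewrite seriesEord; exact: proj_cvg.
  move=> /(_ (divr_gt0 eps0 M1)); apply: filterS => -[m n] /=.
  rewrite ltr_pdivlMr// mulrC => /(le_lt_trans _); apply.
  (* Cutting off the coefficients below [m] turns a block into an initial sum, to which [vM]
     applies. *)
  pose mu i := if (m <= i)%N then es i x else 0.
  have E (Z : normedModType R) (w : nat -> Z) :
      \sum_(m <= i < n) es i x *: w i = \sum_(i < n) mu i *: w i.
    rewrite big_geq_mkord big_mkcond; apply: eq_bigr => i _ /=.
    by rewrite /mu; case: ifP => //; rewrite scale0r.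
  by rewrite !E (le_trans (vM _ _))// ler_wpM2r// lerDl.
have [S cS] := choice cv.
have SM x : `|S x| <= M * `|x|.
  have cM : M * `|\sum_(i < n) es i x *: e i| @[n --> \oo] --> M * `|x|.
    exact: (cvgM (cvg_cst M) (cvg_norm (proj_cvg x))).
  apply: (ler_cvg_to (cvg_norm (cS x)) cM).
  by apply: nearW => n; exact: (vM n (fun i => es i x)).
exists S; split=> //.
- split; last by exists M.
  move=> c x y; apply: (cvgn_unique _ _ _ (cS _)).
  apply: (cvg_trans _ (cvgD (cvgZ (cvg_cst c) (cS x)) (cS y))).
  apply: near_eq_cvg; apply: nearW => n.
  rewrite !fctE scaler_sumr -big_split; apply: eq_bigr => i _.
  by rewrite (hes.1 i).1 scalerDl scalerA.
- move=> n; apply: (cvgn_unique _ _ _ (cS _)).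
  apply: cvg_near_cst; near=> m.
  rewrite sum_es_basis ifT//; near: m; exact: nbhs_infty_gt.
Unshelve. all: by end_near. Qed.

End SchauderBasis.

(** * Norm estimates from a norming set *)

Section Norming.
Context {R : realType} {X : normedModType R} {K : set (X -> R^o)}.
Hypothesis hK : one_norming K.

Lemma norming_ge f x : K f -> (f x : R) <= `|x|.
Proof.
move=> Kf; rewrite -lee_fin hK.2.
by apply: ereal_sup_ubound; exists f.
Qed.

Lemma norming_le x (M : R) : (forall f, K f -> (f x : R) <= M) -> `|x| <= M.
Proof.
move=> KM; rewrite -lee_fin hK.2.
by apply: ge_ereal_sup => _ [f Kf <-]; rewrite lee_fin; exact: KM.
Qed.

End Norming.

Section Equivalence.
Context {R : realType} {X : completeNormedModType R} {e : nat -> X}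
  {es : nat -> X -> R^o} {C1 C2 : R}.
Hypotheses (he : schauder_basis e) (hes : biorthogonal e es)
  (hm : monotone_basis e es) (hC1 : 0 < C1) (hC2 : 0 < C2).

Let dominates_summing := forall n (mu : nat -> R),
  C1 * `|\sum_(i < n) mu i| <= `|\sum_(i < n) mu i *: e i|.

Let submultiplicative := forall n (a b : nat -> R),
  opnorm (\sum_(i < n) (a i * b i) *: es i) <=
  C2 * opnorm (\sum_(i < n) a i *: es i) * opnorm (\sum_(i < n) b i *: es i).

(** * From the diagonal representation to domination and submultiplicativity *)

Section DiagonalRepresentation.
Context {Phi : (X -> R^o) -> X -> X}.
Hypotheses (Phi_fun : set_fun (dual X) (Ldiag e) Phi)
  (Phi_sum : forall (xs : X -> R^o) (lam : nat -> R),
    dual X xs -> wstar_sum es lam xs -> sot_sum e es lam (Phi xs))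
  (Phi_norm : forall xs : X -> R^o, dual X xs ->
    C1 * opnorm xs <= opnorm (Phi xs) <= C2 * opnorm xs).

Lemma Phi_basis f n : dual X f -> Phi f (e n) = (f (e n) : R) *: e n.
Proof.
move=> df; apply: (sot_sum_basis hes (fun n => f (e n))).
by apply: Phi_sum => //; exact: dual_wstar_sum.
Qed.

Lemma Phi_dominates_summing : dominates_summing.
Proof.
move=> n mu; pose f : X -> R^o := \sum_(i < n) (1 : R) *: es i.
have df : dual X f by exact: (finsum_dual hes n (fun=> 1)).
(* Both operators fix [e m] for [m < n] and kill the other basis vectors. Monotonicity of the basis
   then gives [C1 * opnorm f <= 1]. *)
have PhifE : Phi f = \sum_(i < n) rank1 e es i.
  apply: (bounded_op_ext he hes) => [||m].
  - exact: (Phi_fun f df).1.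
  - exact: proj_bounded.
  - have fe : f (e m) = if (m < n)%N then 1 else 0.
      exact: (finsum_app_basis hes n (fun=> 1)).
    rewrite Phi_basis// fe fct_sumE.
    rewrite (sum_es_basis hes e).
    by case: ifP; rewrite ?scale1r ?scale0r.
have fE : f (\sum_(i < n) mu i *: e i) = \sum_(i < n) mu i.
  rewrite /f (finsum_appE n (fun=> 1)); apply: eq_bigr => i _.
  by rewrite finsum_coef// mul1r.
have /andP[C1f _] := Phi_norm f df.
have f1 : C1 * opnorm f <= 1 by rewrite (le_trans C1f)// PhifE.
rewrite -fE (le_trans (ler_wpM2l (ltW hC1) (le_opnorm f _ df)))//.
by rewrite mulrA ler_piMl.
Qed.

Lemma Phi_submultiplicative : submultiplicative.
Proof.
move=> n a b; pose f : X -> R^o := \sum_(i < n) a i *: es i.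
pose g : X -> R^o := \sum_(i < n) b i *: es i.
have df : dual X f by exact: (finsum_dual hes n a).
have dg : dual X g by exact: (finsum_dual hes n b).
have bPhi : bounded_op (Phi g) by exact: (Phi_fun g dg).1.
(* On [e m] both sides equal [a m * b m] for [m < n] and vanish otherwise. *)
have -> : \sum_(i < n) (a i * b i) *: es i = f \o Phi g.
  apply: (bounded_op_ext he hes) => [||m].
  - exact: (finsum_dual hes n (fun i => a i * b i)).
  - exact: bounded_op_comp.
  - rewrite /= Phi_basis// (finsum_app_basis hes n (fun i => a i * b i)).
    have [f' f'E] := linear_funE _ _ _ _ df.1.
    rewrite {1}f'E linearZ -f'E /f /g !finsum_app_basis//.
    by case: ifP => _; [exact: mulrC|exact/esym/mul0r].
have /andP[_ gC2] := Phi_norm g dg.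
rewrite (le_trans (opnorm_comp _ _ df bPhi))// [leLHS]mulrC [leRHS]mulrAC.
by rewrite ler_wpM2r// opnorm_ge0.
Qed.

End DiagonalRepresentation.

(** * The norming ball in the span of the biorthogonal functionals *)

Lemma dominated_norming_set : dominates_summing -> submultiplicative ->
  exists K : set (X -> R^o),
    [/\ one_norming K, K `<=` finspan es,
        forall n : nat, K (C1 *: \sum_(i < n.+1) es i) /\
                        K (- (C1 *: \sum_(i < n.+1) es i))
      & coordprod es K `<=` [set C2 *: f | f in dual_ball X]].
Proof.
move=> dom submul; pose K := [set f | finspan es f /\ opnorm f <= 1].
have Kdual f : K f -> dual X f by move=> [[n [a ->]] _]; exact: (finsum_dual hes n a).
have Kle f x : K f -> `|f x| <= `|x|.
  move=> Kf; rewrite (le_trans (le_opnorm f x (Kdual f Kf)))//.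
  by rewrite ler_piMl// Kf.2.
(* Domination applied to the coordinates of [x], followed by monotonicity of the basis, gives the
   bound; assuming only [|c| = C1] treats both signs at once. *)
have Ksum n c : `|c| = C1 -> K (\sum_(i < n) c *: es i).
  move=> cC1; split; first by exists n, (fun=> c).
  apply: opnorm_le => // x; rewrite mul1r (finsum_appE n (fun=> c)).
  rewrite -mulr_sumr normrM cC1.
  exact: le_trans (dom n (fun i => es i x)) (proj_le hes n x hm).
exists K; split.
- split=> // x; apply/eqP; rewrite eq_le; apply/andP; split; last first.
    apply: ge_ereal_sup => _ [f Kf <-]; rewrite lee_fin.
    by rewrite (le_trans (ler_norm _))// Kle.
  apply/lee_addgt0Pr => _/posnumP[eps].
  have [n] : exists n, `|x| - eps%:num < `|\sum_(i < n) es i x *: e i|.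
    have lex : `|x| - eps%:num < `|x| by rewrite ltrBlDr ltrDl.
    have [n _ /(_ n (leqnn n)) xn] := cvgr_gt _ (cvg_norm (proj_cvg he hes x)) _ lex.
    by exists n.
  (* For [t = 0] the inequality bounds [f z] by the norm of the projection of [z], hence by that of
     [z]. For [t = 1] and coefficients [- es i x] its right-hand side vanishes, which gives
     [|y| <= f x]. *)
  have [a aP] := finite_hahn_banach _ _ (\sum_(i < n) es i x *: e i) e n.
  set y := \sum_(i < n) _ in aP * => xy.
  pose f : X -> R^o := \sum_(i < n) a i *: es i.
  have Kf : K f.
    split; first by exists n, a.
    apply: opnorm_le => // z; rewrite mul1r ler_norml.
    apply/andP; split.
      rewrite lerNl; have := aP 0 (fun i => - es i z).
      rewrite mul0r scale0r !add0r /f finsum_appE.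
      under eq_bigr => i _ do rewrite mulrN.
      rewrite sumrN => /le_trans; apply.
      under eq_bigr => i _ do rewrite scaleNr.
      by rewrite sumrN normrN proj_le.
    have := aP 0 (fun i => es i z).
    rewrite mul0r scale0r !add0r /f finsum_appE => /le_trans; apply.
    exact: proj_le.
  have fx : `|y| <= f x.
    have := aP 1 (fun i => - es i x); rewrite mul1r scale1r /f finsum_appE.
    under eq_bigr => i _ do rewrite mulrN.
    under [X in _ <= `|_ + X|]eq_bigr => i _ do rewrite scaleNr.
    by rewrite !sumrN subrr normr0 subr_le0.
  rewrite (@le_trans _ _ ((f x)%:E + (eps%:num)%:E)%E)//.
    by rewrite -EFinD lee_fin -lerBlDr ltW// (lt_le_trans xy).
  by rewrite leeD2r//; apply: ereal_sup_ubound; exists f.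
- by move=> f [].
- move=> n; rewrite -scaleNr !scaler_sumr.
  by split; apply: Ksum; rewrite ?normrN gtr0_norm.
- move=> _ [n [a [b [Ka Kb ->]]]].
  exists (C2^-1 *: \sum_(i < n) (a i * b i) *: es i); last first.
    by rewrite scalerA mulfV ?gt_eqF// scale1r.
  have hE : C2^-1 *: \sum_(i < n) (a i * b i) *: es i =
      \sum_(i < n) (C2^-1 * (a i * b i)) *: es i.
    by rewrite scaler_sumr; apply: eq_bigr => i _; rewrite scalerA.
  split.
    by rewrite hE; exact: (finsum_dual hes n (fun i => C2^-1 * (a i * b i))).
  apply: opnorm_le => // x; rewrite mul1r fctE normrZ gtr0_norm ?invr_gt0//.
  rewrite ler_pdivrMl// (le_trans (le_opnorm _ x _))//.
    exact: (finsum_dual hes n (fun i => a i * b i)).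
  rewrite ler_wpM2r// (le_trans (submul _ _ _))// -mulrA ler_piMr ?(ltW hC2)//.
  rewrite mulr_ile1 ?Ka.2 ?Kb.2//; apply: opnorm_ge0.
    exact: (finsum_dual hes n a).
  exact: (finsum_dual hes n b).
Qed.

(** * From a norming set to the diagonal representation *)

Section NormingSet.
Context {K : set (X -> R^o)}.
Hypotheses (K_norming : one_norming K) (K_finspan : K `<=` finspan es)
  (K_sums : forall n : nat, K (C1 *: \sum_(i < n.+1) es i) /\
                            K (- (C1 *: \sum_(i < n.+1) es i)))
  (K_prod : coordprod es K `<=` [set C2 *: f | f in dual_ball X]).

Lemma norming_dominates_summing : dominates_summing.
Proof.
(* The sums known to lie in [K] have [n.+1] terms, so the empty sum is treated apart. *)
move=> [|n] mu; first by rewrite !big_ord0 !normr0 mulr0.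
set x := (X in _ <= `|X|).
have sE : (C1 *: \sum_(i < n.+1) es i) x = C1 * \sum_(i < n.+1) mu i.
  rewrite fctE fct_sumE; congr (_ * _).
  by apply: eq_bigr => i _; rewrite finsum_coef.
have [K1 K2] := K_sums n.
rewrite -(gtr0_norm hC1) -normrM -sE ler_norml lerNl.
by rewrite (norming_ge K_norming _ x K1) (norming_ge K_norming _ x K2).
Qed.

(** The left-hand side is the value at the finite vector of the coordinatewise product of [f] and
    [g], which is [C2] times an element of the dual ball. *)
Lemma coordprod_bound f g n (mu : nat -> R) : K f -> K g ->
  \sum_(i < n) mu i * (f (e i) * g (e i)) <= C2 * `|\sum_(i < n) mu i *: e i|.
Proof.
move=> Kf Kg.
have [m1 /(_ _ (leq_maxl m1 _)) fE] := finspan_pad he hes _ (K_finspan _ Kf).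
have [m2 /(_ _ (leq_maxr _ m2)) gE] := finspan_pad he hes _ (K_finspan _ Kg).
move: (fE m2) (gE m1) => {}fE {}gE; set m := maxn m1 m2 in fE gE.
pose h : X -> R^o := \sum_(i < m) ((f (e i) : R) * g (e i)) *: es i.
have [h' [dh' h'1] hE] : [set C2 *: f | f in dual_ball X] h.
  by apply: K_prod; exists m, (f \o e), (g \o e); split=> //=; rewrite -?fE -?gE.
have dh : dual X h by exact: (finsum_dual hes m (fun i => f (e i) * g (e i))).
have -> : \sum_(i < n) mu i * (f (e i) * g (e i)) = h (\sum_(i < n) mu i *: e i).
  rewrite (bounded_op_finsum _ _ _ _ dh); apply: eq_bigr => i _.
  rewrite /h (finsum_app_basis hes m (fun i => f (e i) * g (e i))).
  (* For [i >= m] the padded form gives [f (e i) = 0], so [n] and [m] need not be related. *)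
  case: ltnP => // lemi; rewrite fE (finsum_app_basis hes m (f \o e)).
  by rewrite ltnNge lemi mul0r mulr0 scaler0.
rewrite -hE (le_trans (ler_norm _))// normrM gtr0_norm// ler_wpM2l ?(ltW hC2)//.
by rewrite (le_trans (le_opnorm h' _ dh'))// ler_piMl.
Qed.

(** Testing the left-hand vector against [g] in [K] pairs [mu] with the product of [f] and [g],
    which [coordprod_bound] controls. *)
Lemma norming_diag_bound (f : X -> R^o) n (mu : nat -> R) : K f ->
  `|\sum_(i < n) ((f (e i) : R) * mu i) *: e i| <=
  C2 * `|\sum_(i < n) mu i *: e i|.
Proof.
move=> Kf; apply: (norming_le K_norming) => g Kg.
rewrite (bounded_op_finsum g n (fun i => f (e i) * mu i) e (K_norming.1 _ Kg)).
rewrite (le_trans _ (coordprod_bound _ _ n mu Kf Kg))//.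
by apply: ler_sum => i _; rewrite mulrCA mulrA.
Qed.

(* Duality moves the multiplier from [xs] to [f], so only products of a
   functional with an element of [K] need to be estimated. *)
Lemma dual_diag_bound (xs : X -> R^o) n (mu : nat -> R) : dual X xs ->
  `|\sum_(i < n) mu i *: ((xs (e i) : R) *: e i)| <=
  C2 * opnorm xs * `|\sum_(i < n) mu i *: e i|.
Proof.
move=> dxs; apply: (norming_le K_norming) => f Kf.
have -> : f (\sum_(i < n) mu i *: ((xs (e i) : R) *: e i)) =
    xs (\sum_(i < n) ((f (e i) : R) * mu i) *: e i).
  rewrite (bounded_op_finsum xs n (fun i => f (e i) * mu i) e dxs).
  under eq_bigr do rewrite scalerA.
  rewrite (bounded_op_finsum f n (fun i => mu i * xs (e i)) e (K_norming.1 _ Kf)).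
  by apply: eq_bigr => i _; exact: etrans (mulrC _ _) (mulrA _ _ _).
rewrite (le_trans (ler_norm _))// (le_trans (le_opnorm xs _ dxs))//.
rewrite [C2 * _]mulrC -mulrA ler_wpM2l ?opnorm_ge0//.
exact: norming_diag_bound.
Qed.

Lemma dual_diag_op (xs : X -> R^o) : dual X xs -> exists T : X -> X,
  [/\ bounded_op T, opnorm T <= C2 * opnorm xs
    & forall n, T (e n) = (xs (e n) : R) *: e n].
Proof.
move=> dxs; have C0 : 0 <= C2 * opnorm xs.
  by rewrite mulr_ge0 ?opnorm_ge0// ltW.
have [T [bT TC Te]] :=
  dominated_op he hes (fun i => (xs (e i) : R) *: e i) _ C0
    (fun n mu => dual_diag_bound xs n mu dxs).
by exists T; split=> //; exact: opnorm_le.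
Qed.

(** Domination of the summing basis at the coefficients [mu i * lam i] of the image under [T] bounds
    the functional with values [lam] on finite vectors by [C1^-1 * opnorm T]; [dominated_op] extends
    it to [X]. *)
Lemma diag_op_dual (T : X -> X) (lam : nat -> R) : bounded_op T ->
  (forall n, T (e n) = lam n *: e n) -> exists xs : X -> R^o,
  [/\ dual X xs, C1 * opnorm xs <= opnorm T & forall n, xs (e n) = lam n].
Proof.
move=> bT Te; have C0 : 0 <= C1^-1 * opnorm T.
  by rewrite mulr_ge0 ?opnorm_ge0// invr_ge0 ltW.
have [|xs [dxs xsC xse]] := @dominated_op _ _ _ _ he hes R^o lam _ C0.
  move=> n mu; rewrite -mulrA ler_pdivlMl//.
  rewrite (le_trans (norming_dominates_summing n (fun i => mu i * lam i)))//.
  under eq_bigr do rewrite -scalerA -Te.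
  by rewrite -(bounded_op_finsum _ _ _ _ bT) le_opnorm.
exists xs; split=> //; rewrite -ler_pdivlMl//; exact: opnorm_le.
Qed.

Lemma norming_diagonal_representation :
  exists Phi : (X -> R^o) -> (X -> X),
    [/\ set_fun (dual X) (Ldiag e) Phi,
        forall (xs : X -> R^o) (lam : nat -> R),
          dual X xs -> wstar_sum es lam xs -> sot_sum e es lam (Phi xs),
        forall (c : R) (f g : X -> R^o), dual X f -> dual X g ->
          Phi (c *: f + g) = c *: Phi f + Phi g,
        set_surj (dual X) (Ldiag e) Phi
      & forall xs : X -> R^o, dual X xs ->
          C1 * opnorm xs <= opnorm (Phi xs) <= C2 * opnorm xs].
Proof.
(* The choice is over all maps; outside [dual X] nothing is asked and [0] is an arbitrary
   witness. *)
have /choice[Phi PhiP] xs : exists T : X -> X, dual X xs ->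
    [/\ bounded_op T, opnorm T <= C2 * opnorm xs
      & forall n, T (e n) = (xs (e n) : R) *: e n].
  have [/dual_diag_op[T TP]|nxs] := pselect (dual X xs); first by exists T.
  by exists 0.
(* Linearity and surjectivity both follow from this uniqueness of the diagonal operator. *)
have PhiE xs T : dual X xs -> bounded_op T ->
    (forall n, T (e n) = (xs (e n) : R) *: e n) -> Phi xs = T.
  move=> dxs bT Te; have [bPhi _ Phie] := PhiP _ dxs.
  by apply: (bounded_op_ext he hes) => // n; rewrite Phie Te.
exists Phi; split.
- move=> xs dxs; have [bPhi _ Phie] := PhiP _ dxs.
  by split=> //; exists (xs \o e).
- move=> xs lam dxs lamxs; have [bPhi _ Phie] := PhiP _ dxs.
  apply: (bounded_op_sot_sum he hes) => // n.
  by rewrite Phie (wstar_sum_coef hes _ _ n lamxs).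
- move=> c f g df dg; have [bf _ fe] := PhiP _ df; have [bg _ ge] := PhiP _ dg.
  apply: PhiE => [||n]; [exact: bounded_op_lincomb|exact: bounded_op_lincomb|].
  by rewrite !fctE fe ge scalerA -scalerDl.
- move=> T [bT [lam Te]]; have [xs [dxs _ xse]] := diag_op_dual T lam bT Te.
  by exists xs => //; apply: PhiE => // n; rewrite xse.
- move=> xs dxs; have [bPhi PhiC Phie] := PhiP _ dxs; rewrite PhiC andbT.
  (* The functional recovered from [Phi xs] agrees with [xs] on the basis, hence everywhere, so its
     norm bound is the lower estimate. *)
  have [ys [dys ysC yse]] := diag_op_dual (Phi xs) (xs \o e) bPhi Phie.
  suff E : ys = xs by rewrite -{1}E.
  exact: (bounded_op_ext he hes _ _ dys dxs yse).
Qed.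

End NormingSet.

End Equivalence.

Theorem theorem2p4 (R : realType) (X : completeNormedModType R)
    (e : nat -> X) (es : nat -> X -> R^o) (C1 C2 : R)
    (he : schauder_basis e) (hn : normalized e) (hes : biorthogonal e es)
    (hm : monotone_basis e es) (hC1 : 0 < C1) (hC2 : 0 < C2) :
  [<->
    exists Phi : (X -> R^o) -> (X -> X),
      [/\ set_fun (dual X) (Ldiag e) Phi,
          forall (xs : X -> R^o) (lam : nat -> R),
            dual X xs -> wstar_sum es lam xs -> sot_sum e es lam (Phi xs),
          forall (c : R) (f g : X -> R^o), dual X f -> dual X g ->
            Phi (c *: f + g) = c *: Phi f + Phi g,
          set_surj (dual X) (Ldiag e) Phi
        & forall xs : X -> R^o, dual X xs ->
            C1 * opnorm xs <= opnorm (Phi xs) <= C2 * opnorm xs];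
    (forall (n : nat) (mu : nat -> R),
       C1 * `|\sum_(i < n) mu i| <= `|\sum_(i < n) mu i *: e i|) /\
    (forall (n : nat) (a b : nat -> R),
       opnorm (\sum_(i < n) (a i * b i) *: es i) <=
       C2 * opnorm (\sum_(i < n) a i *: es i)
          * opnorm (\sum_(i < n) b i *: es i));
    exists K : set (X -> R^o),
      [/\ one_norming K, K `<=` finspan es,
          forall n : nat, K (C1 *: \sum_(i < n.+1) es i) /\
                          K (- (C1 *: \sum_(i < n.+1) es i))
        & coordprod es K `<=` [set C2 *: f | f in dual_ball X]]].
Proof.
tfae.
- move=> [Phi [Phi_fun Phi_sum _ _ Phi_norm]]; split.
    exact: (Phi_dominates_summing he hes hm hC1 Phi_fun Phi_sum Phi_norm).
  exact: (Phi_submultiplicative he hes Phi_fun Phi_sum Phi_norm).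
- by move=> [dom submul]; exact: dominated_norming_set.
- move=> [K [K1 K2 K3 K4]].
  exact: (norming_diagonal_representation he hes hC1 hC2 K1 K2 K3 K4).
Qed.
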